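(* The Banach lattice $c_0$ is not $\infty$-projective, and for every $2\le p<\infty$ the Banach lattice $\ell_p$ is not $\infty$-projective.
   Context: $c_0$ and $\ell_p$ are the usual real sequence spaces over $\mathbb{N}$ with their usual norms and the coordinatewise order. A Banach lattice homomorphism is a bounded linear map preserving the lattice operations $\vee,\wedge$. For a real number $\lambda>1$, a Banach lattice $P$ is $\lambda$-projective if whenever $X$ is a Banach lattice, $J$ a closed (order) ideal in $X$ and $Q\colon X\to X/J$ the quotient map, then for every Banach lattice homomorphism $T\colon P\to X/J$ there is a Banach lattice homomorphism $\hat T\colon P\to X$ such that $T=Q\circ\hat T$ and $\|\hat T\|\le\lambda\|T\|$. $P$ is $\infty$-projective if it is $\lambda$-projective for some $\lambda>1$. *)

(* Defs.v *)
From HB Require Import structures.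
From mathcomp Require Import all_boot all_order all_algebra.
From mathcomp Require Import generic_quotient ring_quotient.
From mathcomp Require Import all_classical all_reals all_analysis.

Set Implicit Arguments.
Unset Strict Implicit.
Unset Printing Implicit Defensive.

Import Order.TTheory GRing.Theory Num.Theory numFieldNormedType.Exports.

Local Open Scope classical_set_scope.
Local Open Scope ring_scope.
Local Open Scope quotient_scope.

(* The order is a field of the mixin rather than an inherited [latticeType]:
   Hierarchy Builder rejects a structure extending both [normedModType] and
   [latticeType], because of its existing join [porderZmodType]. *)
HB.mixin Record isBanachLattice (R : realType) X & CompleteNormedModule R X := {
  vle : X -> X -> Prop;
  vjoin : X -> X -> X;
  vmeet : X -> X -> X;
  vle_refl : forall x, vle x x;
  vle_anti : forall x y, vle x y -> vle y x -> x = y;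
  vle_trans : forall y x z, vle x y -> vle y z -> vle x z;
  vleUx : forall x y z, vle (vjoin x y) z <-> vle x z /\ vle y z;
  vlexI : forall x y z, vle x (vmeet y z) <-> vle x y /\ vle x z;
  vleD2r : forall z x y, vle x y -> vle (x + z) (y + z);
  vleZ : forall (a : R) x y, 0 <= a -> vle x y -> vle (a *: x) (a *: y);
  vle_norm : forall x y,
    vle (vjoin x (- x)) (vjoin y (- y)) -> `|x| <= `|y|
}.

#[short(type="banachLatticeType")]
HB.structure Definition BanachLattice (R : realType) :=
  {X of isBanachLattice R X & CompleteNormedModule R X}.

Definition vabs {R : realType} {X : banachLatticeType R} (x : X) : X :=
  vjoin x (- x).

Record closedIdeal (R : realType) (X : banachLatticeType R) := ClosedIdeal {
  ideal_mem :> X -> Prop;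
  ideal0 : ideal_mem 0;
  idealD : forall x y, ideal_mem x -> ideal_mem y -> ideal_mem (x + y);
  idealZ : forall (a : R) x, ideal_mem x -> ideal_mem (a *: x);
  ideal_solid : forall x y, vle (vabs x) (vabs y) -> ideal_mem y -> ideal_mem x;
  ideal_closed : closed [set x | ideal_mem x]
}.

Section BanachLatticeTheory.
Context {R : realType} {X : banachLatticeType R}.
Implicit Types x y z a : X.

Lemma vle_joinl x y : vle x (vjoin x y).
Proof. by have /vleUx[] := vle_refl (vjoin x y). Qed.

Lemma vle_joinr x y : vle y (vjoin x y).
Proof. by have /vleUx[] := vle_refl (vjoin x y). Qed.

Lemma vle_meetl x y : vle (vmeet x y) x.
Proof. by have /vlexI[] := vle_refl (vmeet x y). Qed.

Lemma vle_meetr x y : vle (vmeet x y) y.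
Proof. by have /vlexI[] := vle_refl (vmeet x y). Qed.

Lemma vleD x y z t : vle x y -> vle z t -> vle (x + z) (y + t).
Proof.
move=> xy zt; apply: (vle_trans (y + z)); first exact: vleD2r.
by rewrite ![y + _]addrC; exact: vleD2r.
Qed.

Lemma vleBl x y z : vle x (y + z) -> vle (x - z) y.
Proof. by move=> /(vleD2r (- z)); rewrite addrK. Qed.

Lemma vleBr x y z : vle (x + z) y -> vle x (y - z).
Proof. by move=> /(vleD2r (- z)); rewrite addrK. Qed.

Lemma vleN x y : vle x y -> vle (- y) (- x).
Proof.
move=> /(vleD2r (- x - y)); rewrite addrA subrr add0r.
by rewrite addrCA subrr addr0.
Qed.

Lemma vle_abs x : vle x (vabs x). Proof. exact: vle_joinl. Qed.

Lemma vleN_abs x : vle (- x) (vabs x). Proof. exact: vle_joinr. Qed.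

Lemma vabs_le x a : vle x a -> vle (- x) a -> vle (vabs x) a.
Proof. by move=> xa Nxa; apply/vleUx. Qed.

Lemma vabs_ge0 x : vle 0 (vabs x).
Proof.
have := vleD (vle_abs x) (vleN_abs x); rewrite subrr => h.
have h2 : 0 <= 2^-1 :> R by rewrite invr_ge0 ler0n.
have := @vleZ R X _ _ _ h2 h; rewrite scaler0 scalerDr -scalerDl.
have -> : 2^-1 + 2^-1 = 1 :> R by rewrite [RHS]splitr div1r.
by rewrite scale1r.
Qed.

Lemma vle_absDl x y : vle x (vabs x + vabs y).
Proof.
by rewrite -[X in vle X _]addr0; exact: vleD (vle_abs x) (vabs_ge0 y).
Qed.

Lemma vle_absDr x y : vle y (vabs x + vabs y).
Proof. by rewrite addrC; exact: vle_absDl. Qed.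

Lemma vabs_id x : vabs (vabs x) = vabs x.
Proof.
apply: vle_anti; last exact: vle_abs.
apply: vabs_le; first exact: vle_refl.
apply: vle_trans (vabs_ge0 x).
by have := vleN (vabs_ge0 x); rewrite oppr0.
Qed.

Lemma ideal_abs (J : closedIdeal X) x : J x -> J (vabs x).
Proof. by apply: ideal_solid; rewrite vabs_id; exact: vle_refl. Qed.

Lemma ideal_le (J : closedIdeal X) x y : J y -> vle 0 x -> vle x y -> J x.
Proof.
move=> Jy x0 xy; apply: ideal_solid Jy.
apply: vabs_le; first exact: vle_trans xy (vle_abs _).
apply: vle_trans (vabs_ge0 y).
by have := vleN x0; rewrite oppr0.
Qed.

Lemma ideal_sandwich (J : closedIdeal X) x y z :
  J y -> J z -> vle x y -> vle (- x) z -> J x.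
Proof.
move=> Jy Jz xy xz; apply: (@ideal_solid _ _ J x (vabs y + vabs z)); last first.
  by apply: idealD; exact: ideal_abs.
apply: (vle_trans (vabs y + vabs z)); last exact: vle_abs.
apply: vabs_le.
  rewrite -[x]addr0; apply: vleD (vabs_ge0 z).
  exact: vle_trans xy (vle_abs _).
rewrite -[- x]add0r; apply: vleD (vabs_ge0 y) _.
exact: vle_trans xz (vle_abs _).
Qed.

End BanachLatticeTheory.

Lemma rapid_cauchy_complete (R : realType) (V : normedModType R) :
  (forall u : nat -> V, (forall n, `|u n.+1 - u n| <= 2^-1 ^+ n) -> cvgn u) ->
  forall F : set_system V, ProperFilter F -> cauchy F -> cvg F.
Proof.
move=> cvgV F FF /(@cauchyP R V F FF) F_cauchy.
have e0 n : 0 < 2^-1 ^+ n.+1 :> R by rewrite exprn_gt0// invr_gt0.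
have /choice[u uF] : forall n, exists x : V, F (ball x (2^-1 ^+ n.+1)).
  by move=> n; exact: F_cauchy.
have e2 n : 2^-1 ^+ n = 2^-1 ^+ n.+1 + 2^-1 ^+ n.+1 :> R.
  by rewrite exprS -mulrDl (_ : 2^-1 + 2^-1 = 1) ?mul1r// [RHS]splitr div1r.
have /cvgV/cvg_ex[l ul] : forall n, `|u n.+1 - u n| <= 2^-1 ^+ n.
  move=> n; have [x []] := filter_ex (filterI (uF n) (uF n.+1)).
  rewrite -!ball_normE/= => h1 h2.
  have -> : u n.+1 - u n = (u n.+1 - x) - (u n - x) by rewrite opprB addrA subrK.
  apply: (le_trans (ler_normB _ _)); rewrite (e2 n) lerD//; last exact: ltW.
  apply: (le_trans (ltW h2)); rewrite (e2 n.+1) lerDl; exact: ltW.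
apply/cvg_ex; exists l; apply/fcvgrPdist_lt => e e_gt0.
have /cvgrPdist_lt/(_ (e / 2)) := ul; rewrite divr_gt0// => /(_ isT) H1.
have /cvgrPdist_lt/(_ (e / 2)) : (fun n => 2^-1 ^+ n : R^o) @ \oo --> (0 : R^o).
  by apply: cvg_expr; rewrite gtr0_norm ?invr_gt0// invf_lt1// ltr1n.
rewrite divr_gt0// => /(_ isT) H2.
have [n [/= h1 h2]] := filter_ex (filterI H1 H2).
rewrite sub0r normrN ger0_norm ?exprn_ge0 ?invr_ge0// in h2.
apply: filterS (uF n) => x; rewrite -ball_normE/= => h3.
rewrite -(subrK (u n) l) -addrA [e]splitr.
apply: le_lt_trans (ler_normD _ _) _; apply: ltrD => //.
by apply: lt_trans h2; apply: lt_le_trans h3 _; rewrite [leRHS]e2 lerDl ltW.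
Qed.

Definition ideal_pred (R : realType) (X : banachLatticeType R)
  (J : closedIdeal X) : {pred X} := fun x => `[< J x >].

Section IdealPred.
Variables (R : realType) (X : banachLatticeType R) (J : closedIdeal X).

Let ideal_pred_zmod : zmod_closed (ideal_pred J).
Proof.
split=> [|x y /asboolP Jx /asboolP Jy]; apply/asboolP; first exact: ideal0.
by rewrite -scaleN1r; apply/idealD/idealZ.
Qed.

HB.instance Definition _ :=
  GRing.isZmodClosed.Build X (ideal_pred J) ideal_pred_zmod.

End IdealPred.

Definition lquot (R : realType) (X : banachLatticeType R) (J : closedIdeal X) :=
  Quotient.quot (ideal_pred J).

Section QuotientBanachLattice.
Context {R : realType} {X : banachLatticeType R} (J : closedIdeal X).
Implicit Types (x y : X) (q r : lquot J).

HB.instance Definition _ := GRing.Zmodule.on (lquot J).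

Definition quot_map x : lquot J := \pi_(Quotient.quot (ideal_pred J)) x.
Local Notation pi := quot_map.

Lemma quot_mapP x y : pi x = pi y <-> J (x - y).
Proof.
have E : (pi x == pi y) = `[< J (x - y) >] by rewrite -Quotient.idealrBE.
split=> [/eqP|Jxy]; first by rewrite E => /asboolP.
by apply/eqP; rewrite E; exact/asboolP.
Qed.

Lemma quot_map_surj q : exists x, pi x = q.
Proof. by exists (repr q); rewrite /quot_map reprK. Qed.

Lemma quot_mapD x y : pi (x + y) = pi x + pi y.
Proof. exact: (raddfD (\pi_(Quotient.quot (ideal_pred J)))). Qed.

Lemma quot_mapB x y : pi (x - y) = pi x - pi y.
Proof. exact: (raddfB (\pi_(Quotient.quot (ideal_pred J)))). Qed.

Lemma quot_map0 : pi 0 = 0.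
Proof. by rewrite -(subrr 0) quot_mapB subrr. Qed.

Lemma quot_mapN x : pi (- x) = - pi x.
Proof. by rewrite -sub0r quot_mapB quot_map0 sub0r. Qed.

Definition qscale (a : R) q : lquot J := pi (a *: repr q).

Lemma quot_map_scale a x : qscale a (pi x) = pi (a *: x).
Proof.
apply/quot_mapP; rewrite -scalerBr; apply: idealZ; apply/quot_mapP.
by rewrite /quot_map reprK.
Qed.

Let qscaleA a b q : qscale a (qscale b q) = qscale (a * b) q.
Proof.
by have [x <-] := quot_map_surj q; rewrite !quot_map_scale scalerA.
Qed.

Let qscale1 : left_id 1 qscale.
Proof.
by move=> q; have [x <-] := quot_map_surj q; rewrite quot_map_scale scale1r.
Qed.

Let qscaleDr : right_distributive qscale +%R.
Proof.
move=> a q r; have [x <-] := quot_map_surj q; have [y <-] := quot_map_surj r.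
by rewrite -quot_mapD !quot_map_scale scalerDr quot_mapD.
Qed.

Let qscaleDl q : {morph qscale^~ q : a b / a + b}.
Proof.
move=> a b; have [x <-] := quot_map_surj q.
by rewrite !quot_map_scale scalerDl quot_mapD.
Qed.

HB.instance Definition _ := GRing.Zmodule_isLmodule.Build R (lquot J)
  qscaleA qscale1 qscaleDr qscaleDl.

Lemma quot_mapZ a x : pi (a *: x) = a *: pi x.
Proof. by rewrite -quot_map_scale. Qed.

Definition qnorm q : R := inf [set `|x| | x in [set x | pi x = q]].

Lemma qnorm_ge q c : (forall x, pi x = q -> c <= `|x|) -> c <= qnorm q.
Proof.
move=> cq; apply: lb_le_inf; last by move=> _ [x /= /cq cx <-].
by have [x qx] := quot_map_surj q; exists `|x|, x.
Qed.

Lemma qnorm_le x : qnorm (pi x) <= `|x|.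
Proof.
apply: ge_inf; last by exists x.
by exists 0 => _ [y _ <-].
Qed.

Lemma qnorm_lt q e : qnorm q < e -> exists2 x, pi x = q & `|x| < e.
Proof.
move=> qe; apply: contrapT => h.
have : e <= qnorm q.
  by apply: qnorm_ge => x qx; rewrite leNgt; apply/negP => xe; apply: h; exists x.
by rewrite leNgt qe.
Qed.

Let qnormD q r : qnorm (q + r) <= qnorm q + qnorm r.
Proof.
apply/ler_addgt0Pr => e e0.
have [x <- xe] : exists2 x, pi x = q & `|x| < qnorm q + e / 2.
  by apply: qnorm_lt; rewrite ltrDl divr_gt0.
have [y <- ye] : exists2 y, pi y = r & `|y| < qnorm r + e / 2.
  by apply: qnorm_lt; rewrite ltrDl divr_gt0.
rewrite -quot_mapD; apply: le_trans (qnorm_le _) _.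
apply: le_trans (ler_normD _ _) _.
by rewrite [e in leRHS]splitr addrACA lerD// ltW.
Qed.

Let qnorm_scale_le a q : qnorm (a *: q) <= `|a| * qnorm q.
Proof.
have [->|a0] := eqVneq a 0.
  by rewrite scale0r normr0 mul0r -quot_map0 -[leRHS](@normr0 R X) qnorm_le.
rewrite -ler_pdivrMl ?normr_gt0//; apply: qnorm_ge => x <-.
by rewrite ler_pdivrMl ?normr_gt0// -quot_mapZ -normrZ qnorm_le.
Qed.

Let qnormZ a q : qnorm (a *: q) = `|a| * qnorm q.
Proof.
apply/eqP; rewrite eq_le qnorm_scale_le/=.
have [->|a0] := eqVneq a 0.
  by rewrite normr0 mul0r; apply: qnorm_ge.
rewrite -ler_pdivlMl ?normr_gt0// -normfV -{1}(scale1r q) -(mulVf a0) -scalerA.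
exact: qnorm_scale_le.
Qed.

Let qnorm0_eq0 q : qnorm q = 0 -> q = 0.
Proof.
have [x <-] := quot_map_surj q => q0; rewrite -quot_map0.
apply/quot_mapP; rewrite subr0; apply: (@ideal_closed _ _ J x).
move=> B /nbhs_normP[e /= e0 eB].
have [|y /quot_mapP xy ye] := @qnorm_lt (pi x) e; first by rewrite q0.
exists (x - y); split.
  by rewrite /= -opprB -scaleN1r; exact: idealZ.
by apply: eB; rewrite /= opprB addrC subrK.
Qed.

HB.instance Definition _ := Lmodule_isNormed.Build R (lquot J)
  qnormD qnormZ qnorm0_eq0.

Lemma quot_normE q : `|q| = inf [set `|x| | x in [set x | pi x = q]].
Proof. by []. Qed.

Let lquot_rapid (u : nat -> lquot J) :
  (forall n, `|u n.+1 - u n| <= 2^-1 ^+ n) -> cvgn u.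
Proof.
move=> uP.
have /choice[d dP] : forall n, exists x,
    pi x = u n.+1 - u n /\ `|x| <= 2 * 2^-1 ^+ n.
  move=> n; have [|x xu xn] := @qnorm_lt (u n.+1 - u n) (2 * 2^-1 ^+ n).
    have e0 : 0 < 2^-1 ^+ n :> R by rewrite exprn_gt0// invr_gt0.
    by apply: le_lt_trans (uP n) _; rewrite -[ltLHS]mul1r ltr_pM2r// ltr1n.
  by exists x; split=> //; exact: ltW.
have /normed_cvg/cvg_ex[l dl] : cvgn [normed series d].
  apply: (@series_le_cvg _ _ (geometric 2 2^-1)) => [n|n|n|].
  - exact: normr_ge0.
  - by rewrite mulr_ge0// exprn_ge0// invr_ge0.
  - by have [] := dP n.
  - by apply: is_cvg_geometric_series; rewrite gtr0_norm ?invr_gt0// invf_lt1// ltr1n.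
have [x0 x0u] := quot_map_surj (u 0).
have uE n : u n = pi (x0 + series d n).
  elim: n => [|n IHn]; first by rewrite /series/= big_geq// addr0.
  rewrite seriesSr addrA quot_mapD -IHn (dP n).1.
  by rewrite addrC subrK.
apply/cvg_ex; exists (pi (x0 + l)); apply/cvgrPdist_lt => e e0.
have /cvgrPdist_lt/(_ e e0) := dl; apply: filterS => n ln.
rewrite uE -quot_mapB; apply: le_lt_trans (qnorm_le _) _.
by rewrite opprD addrACA subrr add0r.
Qed.

HB.instance Definition _ := Uniform_isComplete.Build (lquot J)
  (rapid_cauchy_complete lquot_rapid).

(* The positive cone of the quotient is the image of the positive cone. *)

Definition qle q r : Prop := exists x y, [/\ pi x = q, pi y = r & vle x y].

Lemma qleP x y : qle (pi x) (pi y) <-> exists2 j, J j & vle x (y + j).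
Proof.
split=> [[x' [y' [/quot_mapP xx /quot_mapP yy xy]]]|[j Jj xy]].
  exists (y' - y - (x' - x)).
    by apply: idealD => //; rewrite -scaleN1r; exact: idealZ.
  rewrite opprB addrA [y + (y' - y)]addrCA subrr addr0.
  by have := vleD2r (x - x') _ _ xy; rewrite [x' + _]addrC subrK.
exists x, (y + j); split=> //.
by apply/quot_mapP; rewrite addrC addKr.
Qed.

Lemma qle_pi x y : vle x y -> qle (pi x) (pi y).
Proof. by move=> xy; exists x, y. Qed.

Definition qjoin q r : lquot J := pi (vjoin (repr q) (repr r)).

Definition qmeet q r : lquot J := pi (vmeet (repr q) (repr r)).

Let qle_refl q : qle q q.
Proof.
by have [x <-] := quot_map_surj q; apply: qle_pi; exact: vle_refl.
Qed.

Let qle_anti q r : qle q r -> qle r q -> q = r.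
Proof.
have [x <-] := quot_map_surj q; have [y <-] := quot_map_surj r.
move=> /qleP[j Jj xy] /qleP[k Jk yx]; apply/quot_mapP.
apply: (ideal_sandwich Jj Jk); first by apply: vleBl; rewrite addrC.
by rewrite opprB; apply: vleBl; rewrite addrC.
Qed.

Let qle_trans r q s : qle q r -> qle r s -> qle q s.
Proof.
have [x <-] := quot_map_surj q; have [y <-] := quot_map_surj r.
have [z <-] := quot_map_surj s.
move=> /qleP[j Jj xy] /qleP[k Jk yz]; apply/qleP; exists (k + j).
  exact: idealD.
by apply: vle_trans xy _; rewrite addrA; exact: vleD2r.
Qed.

Let qleUx q r s : qle (qjoin q r) s <-> qle q s /\ qle r s.
Proof.
rewrite /qjoin -{2}(reprK q) -{2}(reprK r) -!/(pi _).
move: (repr q) (repr r) => x y; have [z <-] := quot_map_surj s.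
split=> [/qleP[j Jj /vleUx[xj yj]]|[/qleP[j Jj xz] /qleP[k Jk yz]]].
  by split; apply/qleP; exists j.
apply/qleP; exists (vabs j + vabs k).
  by apply: idealD; exact: ideal_abs.
apply/vleUx; split.
  apply: vle_trans xz _; apply: vleD (vle_refl _) _.
  exact: vle_absDl.
apply: vle_trans yz _; apply: vleD (vle_refl _) _.
exact: vle_absDr.
Qed.

Let qleN q r : qle q r -> qle (- r) (- q).
Proof.
move=> [x [y [<- <- xy]]]; rewrite -!quot_mapN; apply: qle_pi; exact: vleN.
Qed.

Let qlexI q r s : qle q (qmeet r s) <-> qle q r /\ qle q s.
Proof.
rewrite /qmeet -{2}(reprK r) -{2}(reprK s) -!/(pi _).
move: (repr r) (repr s) => y z; have [x <-] := quot_map_surj q.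
split=> [h|[/qleP[j Jj xy] /qleP[k Jk xz]]].
  by split; apply: qle_trans h _; apply: qle_pi;
    [exact: vle_meetl|exact: vle_meetr].
apply/qleP; exists (vabs j + vabs k).
  by apply: idealD; exact: ideal_abs.
have lej : vle j (vabs j + vabs k).
  exact: vle_absDl.
have lek : vle k (vabs j + vabs k).
  exact: vle_absDr.
rewrite -[vmeet y z](addrK (vabs j + vabs k)).
have : vle (x - (vabs j + vabs k)) (vmeet y z).
  apply/vlexI; split; apply: vleBl.
    by apply: vle_trans xy (vleD (vle_refl _) lej).
  by apply: vle_trans xz (vleD (vle_refl _) lek).
by move=> /(vleD2r (vabs j + vabs k)); rewrite subrK addrK.
Qed.

Lemma quot_map_join x y : pi (vjoin x y) = qjoin (pi x) (pi y).
Proof.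
have /qleUx[h1 h2] := qle_refl (qjoin (pi x) (pi y)).
apply: qle_anti; last first.
  by apply/qleUx; split; apply: qle_pi; [exact: vle_joinl|exact: vle_joinr].
move: (qjoin _ _) h1 h2 => s; have [z <-] := quot_map_surj s.
move=> /qleP[j Jj xz] /qleP[k Jk yz]; apply/qleP.
exists (vabs j + vabs k); first by apply: idealD; exact: ideal_abs.
apply/vleUx; split.
  apply: vle_trans xz _; apply: vleD (vle_refl _) _.
  exact: vle_absDl.
apply: vle_trans yz _; apply: vleD (vle_refl _) _.
exact: vle_absDr.
Qed.

Lemma quot_map_meet x y : pi (vmeet x y) = qmeet (pi x) (pi y).
Proof.
have /qlexI[h1 h2] := qle_refl (qmeet (pi x) (pi y)).
apply: qle_anti.
  by apply/qlexI; split; apply: qle_pi; [exact: vle_meetl|exact: vle_meetr].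
move: (qmeet _ _) h1 h2 => s; have [z <-] := quot_map_surj s.
move=> /qleP[j Jj zx] /qleP[k Jk zy]; apply/qleP.
exists (vabs j + vabs k); first by apply: idealD; exact: ideal_abs.
rewrite -[z](subrK (vabs j + vabs k)); apply: vleD2r.
apply/vlexI; split; apply: vleBl.
  apply: vle_trans zx (vleD (vle_refl _) _).
  exact: vle_absDl.
apply: vle_trans zy (vleD (vle_refl _) _).
exact: vle_absDr.
Qed.

Let qleD2r r q s : qle q s -> qle (q + r) (s + r).
Proof.
move=> [x [y [<- <- xy]]]; have [z <-] := quot_map_surj r.
by rewrite -!quot_mapD; apply: qle_pi; exact: vleD2r.
Qed.

Let qleZ (a : R) q r : 0 <= a -> qle q r -> qle (a *: q) (a *: r).
Proof.
move=> a0 [x [y [<- <- xy]]]; rewrite -!quot_mapZ; apply: qle_pi.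
exact: vleZ.
Qed.

Let qle_norm q r : qle (qjoin q (- q)) (qjoin r (- r)) -> `|q| <= `|r|.
Proof.
move=> qr; apply: qnorm_ge => y yr; move: qr; rewrite -{}yr.
have [x <-] := quot_map_surj q; rewrite -!quot_mapN -!quot_map_join => xy.
suff -> : pi x = pi (vjoin (vmeet x (vabs y)) (- vabs y)).
  apply: le_trans (qnorm_le _) _; apply: vle_norm.
  have Nyy : vle (- vabs y) (vabs y).
    apply: vle_trans (vabs_ge0 y).
    by have := vleN (vabs_ge0 y); rewrite oppr0.
  apply: vabs_le; first by apply/vleUx; split=> //; exact: vle_meetr.
  by rewrite -[X in vle _ X]opprK; apply: vleN; exact: vle_joinr.
rewrite quot_map_join quot_map_meet; apply: qle_anti.
  have /qleUx[+ _] := qle_refl (qjoin (qmeet (pi x) (pi (vabs y))) (pi (- vabs y))).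
  apply: qle_trans; apply/qlexI; split; first exact: qle_refl.
  apply: qle_trans xy; apply: qle_pi; exact: vle_abs.
apply/qleUx; split.
  by have /qlexI[] := qle_refl (qmeet (pi x) (pi (vabs y))).
apply: (@qle_trans (pi (- vabs x))).
  by rewrite !quot_mapN; exact: qleN.
apply: qle_pi; rewrite -[X in vle _ X]opprK; apply: vleN; exact: vleN_abs.
Qed.

HB.instance Definition _ := isBanachLattice.Build R (lquot J)
  qle_refl qle_anti qle_trans qleUx qlexI qleD2r qleZ qle_norm.

End QuotientBanachLattice.

(* Data for a Banach lattice of sequences with the coordinatewise order: the
   domain, its norm, and the properties making [seqSpace] below a Banach lattice. *)
Record seqLattice (R : realType) := SeqLattice {
  seq_dom : set (nat -> R);
  seq_norm : (nat -> R) -> R;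
  seq_dom0 : seq_dom 0;
  seq_domD : forall u v, seq_dom u -> seq_dom v -> seq_dom (u + v);
  seq_domZ : forall (a : R) u, seq_dom u -> seq_dom (a *: u);
  seq_solid : forall u v, (forall n, `|u n| <= `|v n|) ->
    seq_dom v -> seq_dom u /\ seq_norm u <= seq_norm v;
  seq_normD : forall u v, seq_dom u -> seq_dom v ->
    seq_norm (u + v) <= seq_norm u + seq_norm v;
  seq_normZ : forall (a : R) u, seq_dom u ->
    seq_norm (a *: u) = `|a| * seq_norm u;
  seq_norm_ge : forall u n, seq_dom u -> `|u n| <= seq_norm u;
  seq_complete : forall (u : nat -> nat -> R) (l : nat -> R),
    (forall k, seq_dom (u k)) ->
    (forall n, (u k n : R^o) @[k --> \oo] --> (l n : R^o)) ->
    (forall e, 0 < e ->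
       \forall k \near \oo, forall m, (k <= m)%N ->
         seq_norm (u m - u k) <= e) ->
    seq_dom l /\
    forall e, 0 < e -> \forall k \near \oo, seq_norm (l - u k) <= e
}.

Definition seq_pred (R : realType) (E : seqLattice R) : {pred nat -> R} :=
  fun u => `[< seq_dom E u >].

Section SeqPred.
Variables (R : realType) (E : seqLattice R).

Let seq_pred_submod : submod_closed (seq_pred E).
Proof.
split=> [|a u v /asboolP Eu /asboolP Ev]; apply/asboolP; first exact: seq_dom0.
by apply/seq_domD => //; exact: seq_domZ.
Qed.

HB.instance Definition _ :=
  GRing.isSubmodClosed.Build R (nat -> R) (seq_pred E) seq_pred_submod.

End SeqPred.

Record seqSpace (R : realType) (E : seqLattice R) := SeqSpace {
  seq_val :> nat -> R;
  seq_valP : seq_val \in seq_pred E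
}.

Section SeqSpace.
Context {R : realType} (E : seqLattice R).
Local Notation S := (seqSpace E).

HB.instance Definition _ := [isSub of S for @seq_val R E].
HB.instance Definition _ := [Choice of S by <:].
HB.instance Definition _ := [SubChoice_isSubZmodule of S by <:].
HB.instance Definition _ := [SubZmodule_isSubLmodule of S by <:].

Implicit Types u v w : S.

Lemma seq_domP u : seq_dom E u.
Proof. by apply/asboolP; exact: (valP u). Qed.

Lemma seqP u v : (forall n, u n = v n) -> u = v.
Proof. by move=> uv; apply/val_inj/funext. Qed.

Lemma seq_valD u v : seq_val (u + v) = seq_val u + seq_val v.
Proof. exact: (raddfD (val : S -> nat -> R)). Qed.

Lemma seq_valN u : seq_val (- u) = - seq_val u.
Proof. exact: (raddfN (val : S -> nat -> R)). Qed.

Lemma seq_valB u v : seq_val (u - v) = seq_val u - seq_val v.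
Proof. by rewrite seq_valD seq_valN. Qed.

Lemma seq_valZ (a : R) u : seq_val (a *: u) = a *: seq_val u.
Proof. exact: (linearZ_LR (val : S -> nat -> R)). Qed.

Let snormD u v : seq_norm E (u + v : S) <= seq_norm E u + seq_norm E v.
Proof. by rewrite seq_valD; apply: seq_normD; exact: seq_domP. Qed.

Let snormZ (a : R) u : seq_norm E (a *: u : S) = `|a| * seq_norm E u.
Proof. by rewrite seq_valZ; apply: seq_normZ; exact: seq_domP. Qed.

Let snorm0_eq0 u : seq_norm E u = 0 -> u = 0.
Proof.
move=> u0; apply: seqP => n; apply/eqP; rewrite -normr_le0 -u0.
by apply: seq_norm_ge; exact: seq_domP.
Qed.

HB.instance Definition _ := Lmodule_isNormed.Build R S snormD snormZ snorm0_eq0.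

Lemma seqspace_normE u : `|u| = seq_norm E u. Proof. by []. Qed.

Let seq_rapid (u : nat -> S) :
  (forall n, `|u n.+1 - u n| <= 2^-1 ^+ n) -> cvgn u.
Proof.
move=> uP.
have half1 : `|2^-1| < 1 :> R by rewrite gtr0_norm ?invr_gt0// invf_lt1// ltr1n.
have uD k d : `|u (k + d)%N - u k| <= 2 * 2^-1 ^+ k - 2 * 2^-1 ^+ (k + d).
  elim: d => [|d IHd]; first by rewrite addn0 !subrr normr0.
  rewrite addnS -(subrK (u (k + d)%N) (u (k + d).+1)) -addrA.
  apply: le_trans (ler_normD _ _) _; apply: le_trans (lerD (uP _) IHd) _.
  rewrite exprS mulrA mulfV ?pnatr_eq0// mul1r addrC -addrA lerD2l.
  by rewrite mulr_natl mulr2n opprD addrNK.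
have uC e : 0 < e -> \forall k \near \oo, forall m, (k <= m)%N ->
    `|u m - u k| <= e.
  move=> e0.
  have /cvgrPdist_lt/(_ e e0) := @cvg_geometric R 2 _ half1.
  apply: filterS => k; rewrite sub0r normrN /= ger0_norm; last first.
    by rewrite mulr_ge0// exprn_ge0// invr_ge0.
  move=> ke m /subnKC <-; apply: le_trans (uD _ _) (le_trans _ (ltW ke)).
  by rewrite gerBl mulr_ge0// exprn_ge0// invr_ge0.
have /choice[l ul] : forall n, exists l : R,
    (u k n : R^o) @[k --> \oo] --> (l : R^o).
  move=> n; apply/cvg_ex/cauchy_cvgP/cauchy_exP => e e0.
  have [k _ /(_ k (leqnn k)) kP] := uC _ (divr_gt0 e0 (ltr0n R 2)).
  exists (u k n), k => // m /= km.
  rewrite -ball_normE /= distrC.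
  have -> : u m n - u k n = (u m - u k) n by rewrite seq_valB.
  apply: le_lt_trans (seq_norm_ge _ (seq_domP _)) _.
  apply: le_lt_trans (kP m km) _.
  by rewrite ltr_pdivrMr// ltr_pMr// ltr1n.
have uCE e : 0 < e -> \forall k \near \oo, forall m, (k <= m)%N ->
    seq_norm E (seq_val (u m) - seq_val (u k)) <= e.
  move=> e0; apply: filterS (uC e e0) => k kP m /kP.
  by rewrite seqspace_normE seq_valB.
have [El lP] := seq_complete (fun k => seq_domP (u k)) ul uCE.
have lE : l \in seq_pred E by exact/asboolP.
apply/cvg_ex; exists (SeqSpace lE); apply/cvgrPdist_le => e /lP.
by apply: filterS => k; rewrite seqspace_normE seq_valB.
Qed.

HB.instance Definition _ := Uniform_isComplete.Build S
  (rapid_cauchy_complete seq_rapid).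

Definition seq_le u v : Prop := forall n, u n <= v n.

Let seq_lattice_op (f : R -> R -> R) u v :
  (forall a b, `|f a b| <= `|a| + `|b|) ->
  (fun n => f (u n) (v n)) \in seq_pred E.
Proof.
move=> fP; have absP w : seq_dom E (fun n => `|w n|).
  have [] // := @seq_solid _ E (fun n => `|w n|) (seq_val w) _ (seq_domP w).
  by move=> n; rewrite normr_id.
apply/asboolP; have := seq_domD (absP u) (absP v).
move=> /(seq_solid _) -/(_ (fun n => f (u n) (v n)))[]// n.
rewrite [leRHS]ger0_norm; first exact: fP.
by rewrite addr_ge0.
Qed.

Let max_norm (a b : R) : `|Num.max a b| <= `|a| + `|b|.
Proof. by case: (leP a b) => _; rewrite ?lerDl ?lerDr. Qed.

Let min_norm (a b : R) : `|Num.min a b| <= `|a| + `|b|.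
Proof. by case: (leP a b) => _; rewrite ?lerDl ?lerDr. Qed.

Definition seq_join u v : S := SeqSpace (seq_lattice_op u v max_norm).

Definition seq_meet u v : S := SeqSpace (seq_lattice_op u v min_norm).

Let seq_le_refl u : seq_le u u. Proof. by move=> n. Qed.

Let seq_le_anti u v : seq_le u v -> seq_le v u -> u = v.
Proof. by move=> uv vu; apply: seqP => n; apply/eqP; rewrite eq_le uv vu. Qed.

Let seq_le_trans v u w : seq_le u v -> seq_le v w -> seq_le u w.
Proof. by move=> uv vw n; apply: le_trans (uv n) (vw n). Qed.

Let seq_leUx u v w : seq_le (seq_join u v) w <-> seq_le u w /\ seq_le v w.
Proof.
split=> [h|[uw vw] n]; last by rewrite /= ge_max uw vw.
by split=> n; have := h n; rewrite /= ge_max => /andP[].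
Qed.

Let seq_lexI u v w : seq_le u (seq_meet v w) <-> seq_le u v /\ seq_le u w.
Proof.
split=> [h|[uw vw] n]; last by rewrite /= le_min uw vw.
by split=> n; have := h n; rewrite /= le_min => /andP[].
Qed.

Let seq_leD2r w u v : seq_le u v -> seq_le (u + w) (v + w).
Proof. by move=> uv n; rewrite !seq_valD lerD2r. Qed.

Let seq_leZ (a : R) u v : 0 <= a -> seq_le u v -> seq_le (a *: u) (a *: v).
Proof. by move=> a0 uv n; rewrite !seq_valZ; exact: ler_wpM2l. Qed.

Let seq_le_norm u v :
  seq_le (seq_join u (- u)) (seq_join v (- v)) -> `|u| <= `|v|.
Proof.
move=> uv; have [] // := @seq_solid _ E u v _ (seq_domP v) => n.
have : Num.max (u n) ((- u) n) <= Num.max (v n) ((- v) n) := uv n.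
by rewrite !seq_valN !maxrN.
Qed.

HB.instance Definition _ := isBanachLattice.Build R S
  seq_le_refl seq_le_anti seq_le_trans seq_leUx seq_lexI
  seq_leD2r seq_leZ seq_le_norm.

End SeqSpace.

Section CZero.
Variable R : realType.
Implicit Types u v l : nat -> R.

Definition c0_dom : set (nat -> R) :=
  [set u | (u n : R^o) @[n --> \oo] --> (0 : R^o)].

Definition c0_norm u : R := sup [set `|u n| | n in [set: nat]].

Let c0_norm_le u c : (forall n, `|u n| <= c) -> c0_norm u <= c.
Proof.
move=> uc; apply: ge_sup; first by exists `|u 0|, 0.
by move=> _ [n _ <-].
Qed.

Let c0_norm_ge u n : c0_dom u -> `|u n| <= c0_norm u.
Proof.
move=> u0; apply: ub_le_sup; last by exists n.
have /cvg_seq_bounded : cvgn (u : nat -> R^o) by apply/cvg_ex; exists 0.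
move=> [M [_ uM]]; exists (M + 1) => _ [m _ <-].
by apply: (uM (M + 1)) => //; rewrite ltrDl.
Qed.

Let c0_dom0 : c0_dom 0. Proof. exact: cvg_cst. Qed.

Let c0_domD u v : c0_dom u -> c0_dom v -> c0_dom (u + v).
Proof. by move=> u0 v0; rewrite /c0_dom /= -[0]addr0; exact: cvgD. Qed.

Let c0_domZ (a : R) u : c0_dom u -> c0_dom (a *: u).
Proof. by move=> u0; rewrite /c0_dom /= -(mulr0 a); exact: cvgZr. Qed.

Let c0_solid u v : (forall n, `|u n| <= `|v n|) -> c0_dom v ->
  c0_dom u /\ c0_norm u <= c0_norm v.
Proof.
move=> uv v0; split; last first.
  by apply: c0_norm_le => n; exact: le_trans (uv n) (c0_norm_ge n v0).
apply/cvgr0Pnorm_lt => e e0; have /cvgr0Pnorm_lt/(_ e e0) := v0.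
by apply: filterS => n; exact: le_lt_trans.
Qed.

Let c0_normD u v : c0_dom u -> c0_dom v ->
  c0_norm (u + v) <= c0_norm u + c0_norm v.
Proof.
move=> u0 v0; apply: c0_norm_le => n; apply: le_trans (ler_normD _ _) _.
by apply: lerD; exact: c0_norm_ge.
Qed.

Let c0_norm_ge0 u : c0_dom u -> 0 <= c0_norm u.
Proof. by move=> u0; apply: le_trans (c0_norm_ge 0 u0). Qed.

Let c0_normZ (a : R) u : c0_dom u -> c0_norm (a *: u) = `|a| * c0_norm u.
Proof.
have Zle (b : R) v : c0_dom v -> c0_norm (b *: v) <= `|b| * c0_norm v.
  move=> v0; apply: c0_norm_le => n.
  by rewrite normrM ler_wpM2l// c0_norm_ge.
move=> u0; apply/eqP; rewrite eq_le Zle//=.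
have [->|a0] := eqVneq a 0.
  by rewrite normr0 mul0r; apply: c0_norm_ge0; exact: c0_domZ.
rewrite -ler_pdivlMl ?normr_gt0// -normfV -{1}(scale1r u) -(mulVf a0) -scalerA.
by apply: Zle; exact: c0_domZ.
Qed.

Let c0_complete (u : nat -> nat -> R) l :
  (forall k, c0_dom (u k)) ->
  (forall n, (u k n : R^o) @[k --> \oo] --> (l n : R^o)) ->
  (forall e, 0 < e ->
     \forall k \near \oo, forall m, (k <= m)%N -> c0_norm (u m - u k) <= e) ->
  c0_dom l /\ forall e, 0 < e -> \forall k \near \oo, c0_norm (l - u k) <= e.
Proof.
move=> u0 ul uC.
have domB v w : c0_dom v -> c0_dom w -> c0_dom (v - w).
  by move=> v0 w0; rewrite -scaleN1r; apply/c0_domD/c0_domZ.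
have lu e : 0 < e -> \forall k \near \oo, forall n, `|l n - u k n| <= e.
  move=> e0; apply: filterS (uC e e0) => k kP n.
  have lcv : (u m n - u k n : R^o) @[m --> \oo] --> (l n - u k n : R^o).
    by apply: cvgB; [exact: ul|exact: cvg_cst].
  have /cvg_norm lcv' := lcv.
  rewrite -(cvg_lim (@Rhausdorff R) lcv'); apply: limr_le.
    by apply/cvg_ex; exists `|l n - u k n|.
  exists k => // m /= km; apply: le_trans (kP m km).
  exact: (@c0_norm_ge (u m - u k) n (domB _ _ (u0 m) (u0 k))).
split; last first.
  move=> e /lu; apply: filterS => k kP; apply: c0_norm_le => n; exact: kP.
apply/cvgr0Pnorm_lt => e e0; have e20 : 0 < e / 2 by rewrite divr_gt0.
have [k _ /(_ k (leqnn k)) kP] := lu _ e20.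
have /cvgr0Pnorm_lt/(_ _ e20) := u0 k; apply: filterS => n ukn.
rewrite -(subrK (u k n) (l n)) [e]splitr.
by apply: le_lt_trans (ler_normD _ _) _; apply: ler_ltD.
Qed.

Definition c0_lattice : seqLattice R :=
  SeqLattice c0_dom0 c0_domD c0_domZ c0_solid c0_normD c0_normZ
    (fun u n => @c0_norm_ge u n) c0_complete.

Definition c0 := seqSpace c0_lattice.

End CZero.

Section Lp.
Variables (R : realType) (p : R) (p1 : 1 <= p).
Implicit Types u v l : nat -> R.

Definition lp_sum u : \bar R := (\sum_(0 <= n <oo) (`|u n| `^ p)%:E)%E.

Definition lp_dom : set (nat -> R) := [set u | (lp_sum u < +oo)%E].

Definition lp_norm u : R := fine (lp_sum u) `^ p^-1.

Let p0 : 0 < p. Proof. exact: lt_le_trans ltr01 p1. Qed.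

Let pN0 : p != 0. Proof. by rewrite gt_eqF. Qed.

Let lp_sum_ge0 u : (0 <= lp_sum u)%E.
Proof. by apply: nneseries_ge0 => n _ _; rewrite lee_fin powR_ge0. Qed.

Let lp_normX u : lp_norm u `^ p = fine (lp_sum u).
Proof. by rewrite -powRrM mulVf// powRr1// fine_ge0. Qed.

Let lp_sum_fin u : lp_dom u -> lp_sum u \is a fin_num.
Proof. by move=> u0; rewrite ge0_fin_numE. Qed.

Let lp_partial u N : lp_dom u ->
  \sum_(0 <= n < N) `|u n| `^ p <= lp_norm u `^ p.
Proof.
move=> u0; rewrite lp_normX -lee_fin fineK ?lp_sum_fin// -sumEFin.
by apply: nneseries_lim_ge => n _ _; rewrite lee_fin powR_ge0.
Qed.

Let lp_bound u c : 0 <= c ->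
  (forall N, \sum_(0 <= n < N) `|u n| `^ p <= c `^ p) ->
  lp_dom u /\ lp_norm u <= c.
Proof.
move=> c0 uc.
have uc' : (lp_sum u <= (c `^ p)%:E)%E.
  apply: lime_le.
    by apply: is_cvg_nneseries => n _ _; rewrite lee_fin powR_ge0.
  by apply: nearW => N; rewrite sumEFin lee_fin.
have u0 : lp_dom u by rewrite /lp_dom /=; apply: le_lt_trans uc' (ltry _).
split=> //; rewrite -[leRHS](powRr1 c0) -(mulfV pN0) powRrM.
apply: ge0_ler_powR; rewrite ?invr_ge0 ?(ltW p0)// ?nnegrE ?fine_ge0 ?powR_ge0//.
by rewrite -lee_fin fineK ?lp_sum_fin.
Qed.

Let lp_norm_ge0 u : 0 <= lp_norm u. Proof. exact: powR_ge0. Qed.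

Let lp_norm_ge u n : lp_dom u -> `|u n| <= lp_norm u.
Proof.
move=> /(lp_partial n.+1); rewrite big_nat_recr//= => h.
rewrite leNgt; apply/negP => nu.
have : lp_norm u `^ p < `|u n| `^ p.
  by apply: gt0_ltr_powR => //; rewrite nnegrE.
rewrite ltNge (le_trans _ h)// lerDr sumr_ge0// => i _; exact: powR_ge0.
Qed.

Let lp_solid u v : (forall n, `|u n| <= `|v n|) -> lp_dom v ->
  lp_dom u /\ lp_norm u <= lp_norm v.
Proof.
move=> uv v0; apply: lp_bound => // N; apply: le_trans (lp_partial N v0).
by apply: ler_sum => n _; apply: ge0_ler_powR; rewrite ?nnegrE// ltW.
Qed.

Let lp_dom0 : lp_dom 0.
Proof.
have [] // := @lp_bound 0 0 (lexx _) => N.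
by rewrite big1 ?powR_ge0// => n _; rewrite normr0 powR0.
Qed.

Let lp_LnormE u :
  ('N[counting]_p%:E[EFin \o u] = poweR (lp_sum u) p^-1)%E.
Proof. by rewrite Lnorm_counting. Qed.

Let lp_normE u : lp_dom u -> (lp_norm u)%:E = ('N[counting]_p%:E[EFin \o u])%E.
Proof.
move=> u0; rewrite lp_LnormE /lp_norm -[X in poweR X _](fineK (lp_sum_fin u0)).
by rewrite poweR_EFin.
Qed.

Let lp_normD_dom u v : lp_dom u -> lp_dom v ->
  lp_dom (u + v) /\ lp_norm (u + v) <= lp_norm u + lp_norm v.
Proof.
move=> u0 v0.
have := @minkowski_EFin _ _ _ (@counting nat R) u v p
  (fun=> fun=> fun=> I) (fun=> fun=> fun=> I) p1.
rewrite -(lp_normE u0) -(lp_normE v0) -EFinD -[(u \+ v)%R]/(u + v) => uv.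
have uv0 : lp_dom (u + v).
  rewrite /lp_dom /= ltey; apply/eqP => uvoo.
  move: uv; rewrite lp_LnormE (_ : lp_sum _ = +oo%E)//.
  by rewrite poweRyr ?invr_eq0// leNgt ltry.
split=> //; rewrite -lee_fin lp_normE//.
Qed.

Let lp_domD u v : lp_dom u -> lp_dom v -> lp_dom (u + v).
Proof. by move=> u0 v0; have [] := lp_normD_dom u0 v0. Qed.

Let lp_normD u v : lp_dom u -> lp_dom v ->
  lp_norm (u + v) <= lp_norm u + lp_norm v.
Proof. by move=> u0 v0; have [] := lp_normD_dom u0 v0. Qed.

Let lp_normZ_le (a : R) u : lp_dom u ->
  lp_dom (a *: u) /\ lp_norm (a *: u) <= `|a| * lp_norm u.
Proof.
move=> u0; apply: lp_bound => [|N]; first by rewrite mulr_ge0.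
rewrite powRM//; apply: le_trans (ler_wpM2l _ (lp_partial N u0)).
  rewrite mulr_sumr; apply: ler_sum => n _.
  by rewrite normrM powRM.
exact: powR_ge0.
Qed.

Let lp_domZ (a : R) u : lp_dom u -> lp_dom (a *: u).
Proof. by move=> /(lp_normZ_le a)[]. Qed.

Let lp_normZ (a : R) u : lp_dom u -> lp_norm (a *: u) = `|a| * lp_norm u.
Proof.
move=> u0; apply/eqP; rewrite eq_le (lp_normZ_le a u0).2/=.
have [->|a0] := eqVneq a 0; first by rewrite normr0 mul0r.
rewrite -ler_pdivlMl ?normr_gt0// -normfV -{1}(scale1r u) -(mulVf a0) -scalerA.
by have [] := lp_normZ_le a^-1 (lp_domZ a u0).
Qed.

Let trunc N u : nat -> R := fun n => if (n < N)%N then u n else 0.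

Let trunc_sum N M u :
  \sum_(0 <= n < M) `|trunc N u n| `^ p <= \sum_(0 <= n < N) `|u n| `^ p.
Proof.
have trunc0 n : (N <= n)%N -> `|trunc N u n| `^ p = 0.
  by move=> Nn; rewrite /trunc ltnNge Nn/= normr0 powR0.
have trunc1 n : (n < N)%N -> `|trunc N u n| `^ p = `|u n| `^ p.
  by move=> nN; rewrite /trunc nN.
have [NM|MN] := leqP N M.
  rewrite (@big_cat_nat _ _ _ N) //=.
  rewrite [X in _ + X]big_nat_cond [X in _ + X]big1 ?addr0.
    rewrite big_nat_cond [leRHS]big_nat_cond; apply: ler_sum => n.
    by rewrite andbT => /andP[_ /trunc1 ->].
  by move=> n /andP[/andP[/trunc0]].
rewrite [leRHS](@big_cat_nat _ _ _ M) ?(ltnW MN)//=.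
rewrite -[leLHS]addr0 lerD//.
  rewrite big_nat_cond [leRHS]big_nat_cond; apply: ler_sum => n.
  by rewrite andbT => /andP[_ nM]; rewrite trunc1// (ltn_trans nM).
by rewrite sumr_ge0// => n _; exact: powR_ge0.
Qed.

Let lp_complete (u : nat -> nat -> R) l :
  (forall k, lp_dom (u k)) ->
  (forall n, (u k n : R^o) @[k --> \oo] --> (l n : R^o)) ->
  (forall e, 0 < e ->
     \forall k \near \oo, forall m, (k <= m)%N -> lp_norm (u m - u k) <= e) ->
  lp_dom l /\ forall e, 0 < e -> \forall k \near \oo, lp_norm (l - u k) <= e.
Proof.
move=> u0 ul uC.
have domB v w : lp_dom v -> lp_dom w -> lp_dom (v - w).
  by move=> v0 w0; rewrite -scaleN1r; apply/lp_domD/lp_domZ.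
have truncP N w c : 0 <= c -> \sum_(0 <= n < N) `|w n| `^ p <= c `^ p ->
    lp_dom (trunc N w) /\ lp_norm (trunc N w) <= c.
  by move=> c0 wc; apply: lp_bound => // M; apply: le_trans (trunc_sum _ _ _) wc.
have lu e : 0 < e -> \forall k \near \oo,
    lp_dom (l - u k) /\ lp_norm (l - u k) <= e.
  move=> e0; apply: filterS (uC e e0) => k kP.
  apply: lp_bound => [|N]; first exact: ltW.
  suff [tdom tle] : lp_dom (trunc N (l - u k)) /\
      lp_norm (trunc N (l - u k)) <= e.
    have := lp_partial N tdom.
    have -> : \sum_(0 <= n < N) `|trunc N (l - u k) n| `^ p =
        \sum_(0 <= n < N) `|(l - u k) n| `^ p.
      by apply: eq_big_nat => n /andP[_ nN]; rewrite /trunc nN.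
    move=> h; apply: le_trans h _; apply: ge0_ler_powR; rewrite ?nnegrE//.
      exact: ltW.
    exact: ltW.
  have near_l d : 0 < d -> exists2 m, (k <= m)%N &
      \sum_(0 <= n < N) `|(l - u m) n| `^ p <= d `^ p.
    move=> d0; pose del := (d `^ p / N.+1%:R) `^ p^-1.
    have del0 : 0 < del by rewrite powR_gt0// divr_gt0// powR_gt0.
    have H (i : 'I_N) : \forall m \near \oo, `|l i - u m i| < del.
      by have /cvgrPdist_lt := ul i; exact.
    have HF : \forall m \near \oo, forall i : 'I_N, `|l i - u m i| < del.
      exact: filter_forall.
    have [m [/= Hm km]] := filter_ex (filterI HF (nbhs_infty_ge k)).
    exists m => //; rewrite big_mkord.
    apply: (@le_trans _ _ (\sum_(i < N) del `^ p)).
      apply: ler_sum => i _; apply: ge0_ler_powR; rewrite ?nnegrE//.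
      - exact: ltW.
      - exact: ltW.
      - exact: ltW (Hm i).
    rewrite sumr_const card_ord -powRrM mulVf// powRr1; last first.
      by rewrite divr_ge0// powR_ge0.
    rewrite -[leLHS]mulr_natr -mulrA ler_piMr ?powR_ge0//.
    by rewrite mulrC ler_pdivrMr// mul1r ler_nat.
  have truncD v w : trunc N (v + w) = trunc N v + trunc N w.
    by apply/funext => n; rewrite /trunc /GRing.add /=; case: ifP; rewrite ?addr0.
  have split_l d : 0 < d ->
      lp_dom (trunc N (l - u k)) /\ lp_norm (trunc N (l - u k)) <= d + e.
    move=> d0; have [m km /(truncP _ _ _ (ltW d0))[ldom lle]] := near_l d d0.
    have [] := @truncP N (u m - u k) (lp_norm (u m - u k)) (lp_norm_ge0 _).
      exact/lp_partial/domB.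
    move=> udom ule; have -> : l - u k = (l - u m) + (u m - u k).
      by rewrite addrA subrK.
    rewrite truncD; split; first exact: lp_domD.
    apply: le_trans (lp_normD ldom udom) (lerD lle (le_trans ule (kP m km))).
  split; first by have [] := split_l 1 ltr01.
  apply/ler_addgt0Pl => d d0; exact: (split_l d d0).2.
split; last by move=> e /lu; apply: filterS => k [].
have [k _ /(_ k (leqnn k))[luk _]] := lu 1 ltr01.
by rewrite -(subrK (u k) l); exact: lp_domD.
Qed.

Definition lp_lattice : seqLattice R :=
  SeqLattice lp_dom0 lp_domD lp_domZ lp_solid lp_normD lp_normZ
    (fun u n => @lp_norm_ge u n) lp_complete.

Definition lp := seqSpace lp_lattice.

End Lp.

Lemma c0_normE (R : realType) (u : c0 R) :
  `|u| = sup [set `|u n| | n in [set: nat]].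
Proof. by []. Qed.

Lemma lp_normE (R : realType) (p : R) (p1 : 1 <= p) (u : lp p1) :
  `|u| = fine (\sum_(0 <= n <oo) (`|u n| `^ p)%:E)%E `^ p^-1.
Proof. by []. Qed.

Lemma lp_vleE (R : realType) (p : R) (p1 : 1 <= p) (u v : lp p1) :
  vle u v <-> forall n, u n <= v n.
Proof. by []. Qed.

Record bl_hom (R : realType) (X Y : banachLatticeType R) (T : {linear X -> Y}) :
    Prop := BLHom {
  bl_hom_join : forall x y, T (vjoin x y) = vjoin (T x) (T y);
  bl_hom_meet : forall x y, T (vmeet x y) = vmeet (T x) (T y);
  bl_hom_bounded : exists M, forall x, `|T x| <= M * `|x|
}.

Definition opnorm (R : realType) (X Y : banachLatticeType R)
  (T : {linear X -> Y}) : R := sup [set `|T x| | x in [set x | `|x| <= 1]].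

Definition projective (R : realType) (lam : R) (P : banachLatticeType R) : Prop :=
  forall (X : banachLatticeType R) (J : closedIdeal X) (T : {linear P -> lquot J}),
    bl_hom T ->
    exists T' : {linear P -> X},
      [/\ bl_hom T', forall x, T x = quot_map J (T' x) &
          opnorm T' <= lam * opnorm T].

Definition infty_projective (R : realType) (P : banachLatticeType R) : Prop :=
  exists2 lam : R, 1 < lam & projective lam P.

(* Main.v *)
Require Import Defs.
From HB Require Import structures.
From mathcomp Require Import all_boot all_order all_algebra.
From mathcomp Require Import all_classical all_reals all_analysis.
From mathcomp Require Import lra.

Import Order.TTheory GRing.Theory Num.Theory numFieldNormedType.Exports.

Local Open Scope ring_scope.

(* Split the natural numbers k into infinitely many infinite levels, and let X
   be the lattice of sequences u for which the sums of |u k| along chains (each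
   member smaller than the level of the next) are bounded, normed by the supremum
   of these sums.  Let J be the ideal of those u that tend to 0 along each level.
   A null sequence v induces a class in X/J, that of the u with u k = v (level k)
   for k so large in its level that v is tiny beyond k: along a chain at most one
   term is of the size of v, the others are summable, so |u| <= 2 |v|.  In a lift
   T of this homomorphism the image of the unit vector e_n takes values close to 1
   far out in level n, so one can choose greedily a chain of N points k_j with
   T e_(level k_j) >= 1/2 at k_j.  By positivity the indicator of the N levels has
   an image of norm at least N/2, while its own norm is 1 in c0 and N^(1/p) in lp. *)

(** * Sequence lattices normed by suprema of finite sums *)

Section SupSumLattice.
Local Open Scope classical_set_scope.
Local Open Scope ring_scope.
Context {R : realType} (C : set (seq nat)).
Hypothesis C1 : forall k, C [:: k].
Implicit Types (u v l : nat -> R) (s : seq nat).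

Definition abs_sum u s : R := \sum_(k <- s) `|u k|.

Definition supsum_dom : set (nat -> R) :=
  [set u | exists M, forall s, C s -> abs_sum u s <= M].

Definition supsum_norm u : R := sup [set abs_sum u s | s in C].

Let norm_le u M : (forall s, C s -> abs_sum u s <= M) -> supsum_norm u <= M.
Proof.
move=> uM; apply: ge_sup; first by exists (abs_sum u [:: 0%N]), [:: 0%N].
by move=> _ [s /uM us <-].
Qed.

Lemma supsum_norm_ge u s : supsum_dom u -> C s -> abs_sum u s <= supsum_norm u.
Proof.
move=> [M uM] Cs; apply: ub_le_sup; last by exists s.
by exists M => _ [t /uM ut <-].
Qed.

Let abs_sumD u v s : abs_sum (u + v) s <= abs_sum u s + abs_sum v s.
Proof.
rewrite /abs_sum -big_split; apply: ler_sum => k _; exact: ler_normD.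
Qed.

Let abs_sumZ (a : R) u s : abs_sum (a *: u) s = `|a| * abs_sum u s.
Proof.
by rewrite /abs_sum mulr_sumr; apply: eq_bigr => k _; rewrite -normrM.
Qed.

Let dom0 : supsum_dom 0.
Proof. by exists 0 => s _; rewrite /abs_sum big1// => k _; rewrite normr0. Qed.

Let domD u v : supsum_dom u -> supsum_dom v -> supsum_dom (u + v).
Proof.
move=> [M uM] [N vN]; exists (M + N) => s Cs.
by apply: le_trans (abs_sumD _ _ _) (lerD (uM s Cs) (vN s Cs)).
Qed.

Let domZ (a : R) u : supsum_dom u -> supsum_dom (a *: u).
Proof.
move=> [M uM]; exists (`|a| * M) => s Cs.
by rewrite abs_sumZ ler_wpM2l// uM.
Qed.

Let solid u v : (forall n, `|u n| <= `|v n|) -> supsum_dom v ->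
  supsum_dom u /\ supsum_norm u <= supsum_norm v.
Proof.
move=> uv vdom.
have uvs s : abs_sum u s <= abs_sum v s by exact: ler_sum.
split; last first.
  by apply: norm_le => s Cs; apply: le_trans (uvs s) (supsum_norm_ge _ _ vdom Cs).
by have [M vM] := vdom; exists M => s Cs; exact: le_trans (uvs s) (vM s Cs).
Qed.

Let normD u v : supsum_dom u -> supsum_dom v ->
  supsum_norm (u + v) <= supsum_norm u + supsum_norm v.
Proof.
move=> ud vd; apply: norm_le => s Cs; apply: le_trans (abs_sumD _ _ _) _.
by apply: lerD; exact: supsum_norm_ge.
Qed.

Let norm_ge u n : supsum_dom u -> `|u n| <= supsum_norm u.
Proof.
by move=> /supsum_norm_ge/(_ (C1 n)); rewrite /abs_sum big_seq1.
Qed.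

Let normZ (a : R) u : supsum_dom u ->
  supsum_norm (a *: u) = `|a| * supsum_norm u.
Proof.
have Zle (b : R) v : supsum_dom v -> supsum_norm (b *: v) <= `|b| * supsum_norm v.
  move=> vd; apply: norm_le => s Cs.
  by rewrite abs_sumZ ler_wpM2l// supsum_norm_ge.
move=> ud; apply/eqP; rewrite eq_le Zle//=.
have [->|a0] := eqVneq a 0.
  by rewrite normr0 mul0r; apply: le_trans (norm_ge _ 0%N (domZ 0 _ ud)).
rewrite -ler_pdivlMl ?normr_gt0// -normfV -{1}(scale1r u) -(mulVf a0) -scalerA.
exact/Zle/domZ.
Qed.

(** Each [abs_sum] is a finite sum, so the Cauchy bound passes to the coordinatewise limit one [s]
    at a time, with a threshold for [k] that is independent of [s]. *)
Let complete (u : nat -> nat -> R) l :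
  (forall k, supsum_dom (u k)) ->
  (forall n, (u k n : R^o) @[k --> \oo] --> (l n : R^o)) ->
  (forall e, 0 < e ->
     \forall k \near \oo, forall m, (k <= m)%N -> supsum_norm (u m - u k) <= e) ->
  supsum_dom l /\
  forall e, 0 < e -> \forall k \near \oo, supsum_norm (l - u k) <= e.
Proof.
move=> ud ul uC.
have domB v w : supsum_dom v -> supsum_dom w -> supsum_dom (v - w).
  by move=> vd wd; rewrite -scaleN1r; exact/domD/domZ.
have lu e : 0 < e -> \forall k \near \oo, forall s, C s -> abs_sum (l - u k) s <= e.
  move=> e0; apply: filterS (uC e e0) => k kP s Cs.
  have lcv : (abs_sum (u m - u k) s : R^o) @[m --> \oo] -->
             (abs_sum (l - u k) s : R^o).
    apply: (@cvg_big R^o nat +%R 0 xpredT) => [|n _]; first exact: add_continuous.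
    by apply: cvg_norm; apply: cvgB; [exact: ul|exact: cvg_cst].
  rewrite -(cvg_lim (@Rhausdorff R) lcv); apply: limr_le.
    by apply/cvg_ex; exists (abs_sum (l - u k) s).
  exists k => // m /= km; apply: le_trans (kP m km).
  by apply: supsum_norm_ge => //; exact: domB.
split; last by move=> e /lu; apply: filterS => k; exact: norm_le.
have [k _ /(_ k (leqnn k)) kP] := lu _ ltr01.
by rewrite -(subrK (u k) l); apply: domD => //; exists 1.
Qed.

Definition supsum_lattice : seqLattice R :=
  SeqLattice dom0 domD domZ solid normD normZ (fun u n => @norm_ge u n) complete.

End SupSumLattice.

(** * Levels and chains of natural numbers *)

Definition level (k : nat) : nat := logn 2 k.

Lemma level_le k : (level k <= k)%N.
Proof. by case: k => [|k] //; apply: ltnW; exact: ltn_logl. Qed.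

Lemma level_unbounded n B : exists2 k, (B <= k)%N & level k = n.
Proof.
(* Odd multiples of [2 ^ n] have 2-adic valuation exactly [n]. *)
exists (2 ^ n * (B.*2.+1))%N.
  apply: (@leq_trans (B.*2.+1)); last by rewrite leq_pmull// expn_gt0.
  by rewrite -addnn; apply: leqW; exact: leq_addr.
rewrite /level lognM ?expn_gt0// pfactorK// logn_coprime ?addn0//.
by rewrite coprime2n /= odd_double.
Qed.

(** As [level k <= k], both the points and their levels increase strictly along a chain for this
    relation. *)
Definition lprec : rel nat := fun j k => (j < level k)%N.

Lemma lprec_trans : transitive lprec.
Proof.
move=> b a c ab bc; apply: leq_trans (ltnW bc).
by apply: leq_trans ab _; exact: level_le.
Qed.

(** * The chain lattice and the ideal of sequences null on each level *)

Section ChainLattice.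
Local Open Scope classical_set_scope.
Local Open Scope ring_scope.
Context {R : realType}.

Lemma chain1 k : [set s | sorted lprec s] [:: k].
Proof. by []. Qed.

Definition chain_space := seqSpace (supsum_lattice (R := R) _ chain1).

Implicit Types u v : chain_space.

Lemma chain_norm_ge u s : sorted lprec s -> \sum_(k <- s) `|u k| <= `|u|.
Proof. exact: (supsum_norm_ge _ _ _ (seq_domP u)). Qed.

Definition level_null u : Prop := forall n (e : R), 0 < e ->
  exists K, forall k, (K <= k)%N -> level k = n -> `|u k| <= e.

Let null0 : level_null 0.
Proof. by move=> n e e0; exists 0%N => k _ _; rewrite normr0 ltW. Qed.

Let nullD u v : level_null u -> level_null v -> level_null (u + v).
Proof.
move=> u0 v0 n e e0; have e2 : 0 < e / 2 by rewrite divr_gt0.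
have [K uK] := u0 n _ e2; have [L vL] := v0 n _ e2.
exists (maxn K L) => k; rewrite geq_max => /andP[Kk Lk] kn.
rewrite seq_valD; apply: le_trans (ler_normD _ _) _.
by rewrite [e]splitr lerD// ?uK ?vL.
Qed.

Let nullZ (a : R) u : level_null u -> level_null (a *: u).
Proof.
move=> u0 n e e0; have a0 : 0 < `|a| + 1 by rewrite ltr_wpDl.
have [K uK] := u0 n _ (divr_gt0 e0 a0); exists K => k Kk kn.
rewrite seq_valZ normrM; apply: (@le_trans _ _ ((`|a| + 1) * `|u k|)).
  by rewrite ler_wpM2r// lerDl.
by rewrite mulrC -ler_pdivlMr// uK.
Qed.

Let null_solid u v : vle (vabs u) (vabs v) -> level_null v -> level_null u.
Proof.
move=> uv v0 n e e0; have [K vK] := v0 n e e0; exists K => k Kk kn.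
apply: le_trans (vK k Kk kn).
have : Num.max (u k) ((- u) k) <= Num.max (v k) ((- v) k) := uv k.
by rewrite !seq_valN !maxrN.
Qed.

(** The norm dominates every coordinate, so norm approximation is uniform and preserves convergence
    to 0 along a level. *)
Let null_closed : closed [set u | level_null u].
Proof.
move=> u clu n e e0; have e2 : 0 < e / 2 by rewrite divr_gt0.
have [v [/= v0 uv]] := clu _ (nbhsx_ballx u _ e2).
have [K vK] := v0 n _ e2; exists K => k Kk kn.
rewrite -(subrK (v k) (u k)) [e]splitr; apply: le_trans (ler_normD _ _) _.
rewrite lerD// ?vK//; move: uv; rewrite -ball_normE /= => /ltW; apply: le_trans.
have -> : u k - v k = (u - v) k by rewrite seq_valB.
exact: seq_norm_ge (seq_domP _).
Qed.

Definition level_ideal : closedIdeal chain_space :=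
  ClosedIdeal null0 nullD nullZ null_solid null_closed.

End ChainLattice.

(** * The homomorphism into the quotient *)

Section Lifting.
Local Open Scope classical_set_scope.
Local Open Scope ring_scope.
Context {R : realType} (E : seqLattice R).
Hypothesis E_null : forall u, seq_dom E u -> c0_dom u.
Notation P := (seqSpace E).
Implicit Types (u v : P) (s : seq nat).

Lemma norm_seq_ge v k : `|v k| <= `|v|.
Proof. exact: seq_norm_ge (seq_domP v). Qed.

(** If [j] follows [k] in a chain, then [level j > k], so the value of [v] at [level j] obeys this
    bound. The exponent makes such bounds sum geometrically along the chain. *)
Definition active v k : Prop :=
  forall m, (k < m)%N -> `|v m| <= 2^-1 ^+ (level k).+1 * `|v|.

(** On a fixed level the threshold is one constant, and [v] tends to 0. The constant is positive
    unless [v] has norm 0. *)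
Lemma near_active v n :
  exists K, forall k, (K <= k)%N -> level k = n -> active v k.
Proof.
have [v0|v0] := eqVneq (`|v|) 0.
  by exists 0%N => k _ _ m _; rewrite v0 mulr0 -v0; exact: norm_seq_ge.
have e0 : 0 < 2^-1 ^+ n.+1 * `|v|.
  by rewrite mulr_gt0 ?exprn_gt0 ?invr_gt0// lt_def v0 normr_ge0.
have /cvgr0Pnorm_lt/(_ _ e0)[K _ KP] := E_null _ (seq_domP v).
exists K => k Kk kn m km; rewrite kn; apply/ltW/KP.
by apply: leq_trans Kk _; exact: ltnW.
Qed.

Definition spread v k : R := if `[< active v k >] then v (level k) else 0.

Lemma spread_active v k : active v k -> spread v k = v (level k).
Proof. by move=> vk; rewrite /spread asboolT. Qed.

(** The first active [j] after [k] contributes at most [2^-1 ^+ (level k).+1] times the norm,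
    because [k] is active. The rest contributes at most [2^-1 ^+ level j] times the norm, which is
    no larger since [level j > level k]. *)
Lemma spread_path v k s : active v k -> path lprec k s ->
  abs_sum (spread v) s <= 2^-1 ^+ level k * `|v|.
Proof.
elim: s k => [|j s IHs] k vk /=.
  by rewrite /abs_sum big_nil mulr_ge0// exprn_ge0// invr_ge0.
move=> /andP[kj js]; rewrite /abs_sum big_cons -/(abs_sum _ _).
have [vj|vj] := pselect (active v j); last first.
  (* An inactive [j] contributes 0 and is dropped from the path by transitivity. *)
  rewrite /spread asboolF// normr0 add0r; apply: IHs vk _.
  exact: path_le lprec_trans _ _ _ kj js.
rewrite spread_active//; apply: le_trans (lerD (vk _ kj) (IHs _ vj js)) _.
rewrite -mulrDl ler_wpM2r//.
have jk : 2^-1 ^+ level j <= 2^-1 ^+ (level k).+1 :> R.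
  rewrite ler_wiXn2l ?invr_ge0// ?invf_le1 ?ler1n//.
  by apply: leq_ltn_trans kj; exact: level_le.
by apply: le_trans (lerD (lexx _) jk) _; rewrite exprS; lra.
Qed.

Lemma spread_chain v s : sorted lprec s -> abs_sum (spread v) s <= 2 * `|v|.
Proof.
elim: s => [|k s IHs] /= ks; first by rewrite /abs_sum big_nil mulr_ge0.
rewrite /abs_sum big_cons -/(abs_sum _ _).
have [vk|vk] := pselect (active v k); last first.
  by rewrite /spread asboolF// normr0 add0r; apply/IHs/path_sorted/ks.
rewrite spread_active// [2]mulr2n mulrDl mul1r.
apply: lerD (norm_seq_ge _ _) (le_trans (spread_path _ _ _ vk ks) _).
by rewrite ler_piMl// exprn_ile1 ?invr_ge0// invf_le1 ?ler1n.
Qed.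

Lemma spread_dom v :
  spread v \in seq_pred (supsum_lattice (R := R) _ chain1).
Proof. by apply/asboolP; exists (2 * `|v|) => s; exact: spread_chain. Qed.

Definition spread_elt v : chain_space := SeqSpace (spread_dom v).

Lemma spread_norm v : `|spread_elt v| <= 2 * `|v|.
Proof.
apply: ge_sup; first by exists (abs_sum (spread v) [::]), [::].
by move=> _ [s ss <-]; exact: spread_chain.
Qed.

Local Notation J := (@level_ideal R).
Local Notation pi := (quot_map J).

Lemma eventually_level_ideal (f : chain_space) :
  (forall n, exists K, forall k, (K <= k)%N -> level k = n -> f k = 0) -> J f.
Proof.
move=> f0; rewrite /= => n e e0; have [K fK] := f0 n; exists K => k Kk kn.
by rewrite fK// normr0 ltW.
Qed.

Definition spread_class v : lquot J := pi (spread_elt v).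

(** [spread] itself is not linear, as activity depends on the vector. Far out on each level all
    vectors involved are active, and there [spread] is evaluation at the level. *)
Let spread_linear : linear spread_class.
Proof.
move=> a u v; rewrite -quot_mapZ -quot_mapD; apply/quot_mapP.
apply: eventually_level_ideal => n.
have [K1 h1] := near_active u n; have [K2 h2] := near_active v n.
have [K3 h3] := near_active (a *: u + v) n.
exists (maxn K1 (maxn K2 K3)) => k; rewrite !geq_max => /and3P[k1 k2 k3] kn.
rewrite seq_valB seq_valD seq_valZ.
rewrite [LHS](_ : _ = spread (a *: u + v) k - (a * spread u k + spread v k))//.
rewrite (spread_active _ _ (h1 k k1 kn)) (spread_active _ _ (h2 k k2 kn)).
rewrite (spread_active _ _ (h3 k k3 kn)).
by rewrite seq_valD seq_valZ; exact: subrr.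
Qed.

HB.instance Definition _ := GRing.isLinear.Build R P (lquot J) _
  spread_class spread_linear.

Let spread_op (f : R -> R -> R) (w : P) (g : chain_space) u v :
  (forall n, w n = f (u n) (v n)) ->
  (forall k, g k = f (spread u k) (spread v k)) ->
  pi (spread_elt w) = pi g.
Proof.
move=> wE gE; apply/quot_mapP; apply: eventually_level_ideal => n.
have [K1 h1] := near_active u n; have [K2 h2] := near_active v n.
have [K3 h3] := near_active w n.
exists (maxn K1 (maxn K2 K3)) => k; rewrite !geq_max => /and3P[k1 k2 k3] kn.
rewrite seq_valB [LHS](_ : _ = spread w k - g k)// gE.
rewrite !spread_active; [|exact: h2|exact: h1|exact: h3].
by rewrite wE subrr.
Qed.

Lemma spread_hom : bl_hom spread_class.
Proof.
split=> [u v|u v|].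
- rewrite [RHS](_ : _ = pi (vjoin (spread_elt u) (spread_elt v))).
    exact: (@spread_op Num.max).
  by rewrite quot_map_join.
- rewrite [RHS](_ : _ = pi (vmeet (spread_elt u) (spread_elt v))).
    exact: (@spread_op Num.min).
  by rewrite quot_map_meet.
- by exists 2 => v; apply: le_trans (qnorm_le _ _) (spread_norm v).
Qed.

(** * Growth of indicators against a lift *)

Definition indicator (A : seq nat) (n : nat) : R := (n \in A)%:R.

Variable c : nat -> R.
Hypothesis E_indicator : forall A, uniq A ->
  seq_dom E (indicator A) /\ seq_norm E (indicator A) <= c (size A).
Hypothesis c_small : forall M : R, exists N, M * c N < N%:R / 2.

Let ind_dom A : uniq A -> indicator A \in seq_pred E.
Proof. by move=> /E_indicator[AE _]; exact/asboolP. Qed.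

Let ind A (uA : uniq A) : P := SeqSpace (ind_dom _ uA).

Let unit_elt n : P := ind [:: n] isT.

Section Lift.
Variables (T : {linear P -> @chain_space R}) (T_hom : bl_hom T).
Hypothesis T_lift : forall v, spread_class v = pi (T v).

Let T_mono u v k : vle u v -> T u k <= T v k.
Proof.
move=> uv; have uvE : vjoin u v = v.
  apply: vle_anti; last exact: vle_joinr.
  by apply/vleUx; split=> //; exact: vle_refl.
have /(congr1 (fun x : chain_space => x k)) := bl_hom_join T_hom u v.
by rewrite uvE => ->; rewrite /= le_max lexx.
Qed.

Let T_unit n : exists k, [/\ level k = n, (n <= k)%N & 2^-1 <= T (unit_elt n) k].
Proof.
have /quot_mapP /= /(_ n 2^-1) := T_lift (unit_elt n).
rewrite invr_gt0 => /(_ (ltr0n _ _))[K KP].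
have [L LP] := near_active (unit_elt n) n.
have [k] := level_unbounded n (maxn n (maxn K L)).
rewrite !geq_max => /and3P[nk Kk Lk] kn; exists k; split=> //.
have := KP k Kk kn; rewrite seq_valB.
rewrite [X in `|X|](_ : _ = spread (unit_elt n) k - T (unit_elt n) k)//.
rewrite (spread_active _ _ (LP k Lk kn)) kn /= /indicator inE eqxx.
by rewrite ler_norml mulr1n => /andP[_]; lra.
Qed.

Lemma chain_of_units N : exists s, [/\ size s = N, sorted lprec s,
  uniq [seq level k | k <- s] &
  forall k, k \in s -> 2^-1 <= T (unit_elt (level k)) k].
Proof.
have /choice[kap kapP] := T_unit.
(* The next point is taken on level [(st i).+1], just above the previous point, so that [lprec]
   holds. *)
pose st := fix st j := if j is i.+1 then kap (st i).+1 else kap 0%N.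
have stS j : lprec (st j) (st j.+1).
  by have [h _ _] := kapP (st j).+1; rewrite /lprec /= h.
pose s := [seq st j | j <- iota 0 N].
have sP : sorted lprec s.
  rewrite sorted_map; apply: (@sub_sorted _ ltn); last exact: iota_ltn_sorted.
  by apply: (homo_ltn lprec_trans) => // j; exact: stS.
exists s; split=> //.
- by rewrite size_map size_iota.
- apply: (sorted_uniq ltn_trans ltnn); rewrite sorted_map.
  apply: sub_sorted sP => j k jk; apply: leq_ltn_trans jk; exact: level_le.
- move=> k /mapP[j _ ->]; case: j => [|j] /=.
    by have [-> _] := kapP 0%N.
  by have [-> _] := kapP (st j).+1.
Qed.

Lemma no_lift : False.
Proof.
have [M TM] := bl_hom_bounded T_hom.
(* The bound [M] may be negative; a nonnegative factor is needed to replace the norm of the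
   indicator by [c N]. *)
have [N MN] := c_small (Num.max M 0).
have [s [sN ss us sT]] := chain_of_units N.
have := chain_norm_ge (T (ind _ us)) _ ss.
apply/negP; rewrite -ltNge; apply: le_lt_trans (TM _) _.
apply: (@le_lt_trans _ _ (Num.max M 0 * c N)).
  apply: (@le_trans _ _ (Num.max M 0 * `|ind _ us|)).
    by rewrite ler_wpM2r// le_max lexx.
  rewrite ler_wpM2l ?le_max ?lexx ?orbT//.
  by have [_] := E_indicator _ us; rewrite size_map sN.
apply: lt_le_trans MN _.
have -> : N%:R / 2 = \sum_(k <- s) 2^-1 :> R.
  by rewrite big_const_seq count_predT sN iter_addr addr0 mulr_natl.
(* The indicator dominates the unit vector of each [level k], so by monotonicity its image is at
   least 1/2 at every point of the chain. *)
rewrite big_seq [leRHS]big_seq; apply: ler_sum => k ks.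
apply: le_trans (sT k ks) (le_trans (T_mono _ (ind _ us) _ _) (ler_norm _)).
move=> n /=; rewrite /indicator inE ler_nat.
by case: eqP => // ->; rewrite map_f.
Qed.

End Lift.

Lemma not_infty_projective : ~ infty_projective P.
Proof.
move=> [lam _ /(_ _ _ _ spread_hom)[T [T_hom T_lift _]]].
exact: no_lift T_hom T_lift.
Qed.

End Lifting.

(** * Application to [c0] and [lp] *)

Section Examples.
Local Open Scope classical_set_scope.
Local Open Scope ring_scope.
Context {R : realType}.

Lemma indicator_cvg0 (A : seq nat) : c0_dom (indicator (R := R) A).
Proof.
apply/cvgr0Pnorm_lt => e e0; exists (\max_(i <- A) i).+1 => // n /= An.
rewrite /indicator; case: (boolP (n \in A)) => [nA|]; last by rewrite normr0.
by move: An; rewrite ltnNge leq_bigmax_seq.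
Qed.

Lemma not_infty_projective_c0 : ~ infty_projective (c0 R).
Proof.
apply: (@not_infty_projective _ (c0_lattice R) _ (fun=> 1)) => //.
  move=> A _; split; first exact: indicator_cvg0.
  apply: ge_sup; first by exists `|indicator (R := R) A 0|, 0%N.
  by move=> _ [n _ <-]; rewrite /indicator; case: (_ \in _); rewrite ?normr0 ?normr1.
move=> M; exists (Num.truncn (2 * M)).+1; rewrite mulr1 ltr_pdivlMr// mulrC.
exact: truncnS_gt.
Qed.

Variables (p : R) (p1 : 1 <= p).

Let p0 : 0 < p. Proof. exact: lt_le_trans p1. Qed.

Lemma lp_dom_cvg0 (u : nat -> R) : lp_dom p u -> c0_dom u.
Proof.
move=> /nnseries_is_cvg -/(_ (fun=> powR_ge0 _ _))/cvg_series_cvg_0.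
move=> /cvgr0Pnorm_lt up; apply/cvgr0Pnorm_lt => e e0.
apply: filterS (up _ (powR_gt0 p e0)) => n; rewrite ger0_norm ?powR_ge0//.
rewrite !ltNge; apply: contra => en.
by apply: ge0_ler_powR; rewrite ?nnegrE// ltW.
Qed.

(** Each partial sum counts the members of [A] below [N]. *)
Lemma lp_sum_indicator (A : seq nat) : uniq A ->
  (lp_sum p (indicator (R := R) A) <= (size A)%:R%:E)%E.
Proof.
move=> uA; apply: lime_le.
  by apply: is_cvg_nneseries => n _ _; rewrite lee_fin powR_ge0.
apply: nearW => N; rewrite sumEFin lee_fin.
rewrite (eq_bigr (fun n => (n \in A)%:R)); last first.
  move=> n _; rewrite /indicator; case: (_ \in _).
    by rewrite normr1 powR1.
  by rewrite normr0 powR0// gt_eqF.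
rewrite -natr_sum ler_nat -big_mkcond /= sum1_count -size_filter.
apply: uniq_leq_size; first by rewrite filter_uniq// iota_uniq.
by move=> n; rewrite mem_filter => /andP[].
Qed.

Lemma not_infty_projective_lp : 1 < p -> ~ infty_projective (lp p1).
Proof.
move=> p_gt1.
apply: (@not_infty_projective _ (lp_lattice p1) lp_dom_cvg0
  (fun N => N%:R `^ p^-1)) => [A uA|M].
  have h := lp_sum_indicator _ uA.
  have h0 : (0 <= lp_sum p (indicator (R := R) A))%E.
    by apply: nneseries_ge0 => n _ _; rewrite lee_fin powR_ge0.
  have hoo : (lp_sum p (indicator (R := R) A) < +oo)%E.
    by apply: le_lt_trans h (ltry _).
  split=> //; apply: ge0_ler_powR; rewrite ?invr_ge0 ?(ltW p0) ?nnegrE ?fine_ge0//.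
  by rewrite -lee_fin fineK// ge0_fin_numE.
have q0 : 0 < 1 - p^-1 by rewrite subr_gt0 invf_lt1.
pose M' := Num.max (2 * M) 0.
have M'0 : 0 <= M' by rewrite le_max lexx orbT.
pose N := (Num.truncn (M' `^ (1 - p^-1)^-1)).+1; exists N.
have N0 : 0 < N%:R :> R by rewrite ltr0n.
have M'N : M' < N%:R `^ (1 - p^-1).
  have <- : (M' `^ (1 - p^-1)^-1) `^ (1 - p^-1) = M'.
    by rewrite -powRrM mulVf ?lt0r_neq0// powRr1.
  by apply: gt0_ltr_powR; rewrite ?nnegrE ?powR_ge0 ?truncnS_gt// ltW.
rewrite ltr_pdivlMr// mulrC mulrA; apply: (@le_lt_trans _ _ (M' * N%:R `^ p^-1)).
  by rewrite ler_wpM2r ?powR_ge0// le_max lexx.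
rewrite [ltRHS](_ : _ = N%:R `^ (1 - p^-1) * N%:R `^ p^-1); last first.
  by rewrite -powRD ?subrK ?powRr1 ?ltW// lt0r_neq0 ?implybT.
by rewrite ltr_pM2r// powR_gt0.
Qed.

End Examples.

Theorem corollary2p2 (R : realType) :
  ~ infty_projective (c0 R) /\
  forall (p : R) (p1 : 1 <= p), 2 <= p -> ~ infty_projective (lp p1).
Proof.
split=> [|p p1 p2]; first exact: not_infty_projective_c0.
by apply: not_infty_projective_lp; apply: lt_le_trans p2; rewrite ltr1n.
Qed.
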